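(* Let $G=(V,E)$ be a finite weighted graph with edge weights $\mu$, and let $\Omega\subset V$ be nonempty, such that $\widetilde{\Omega}$ is connected and $\delta\Omega$ has at least two vertices. Let $\lambda_1(\Omega)$ be the first nontrivial eigenvalue of the Dirichlet-to-Neumann operator $\Lambda$ on $\Omega$. Then for all real $a>0$ and $k>0$, $$\lambda_1(\Omega)\geq\frac{\left(2h_E(\widetilde{\Omega})\mu_1(k)-a(k+\mu_1(k))\right)a}{a^2+2\mu_1(k)},$$ where $\mu_1(k)$ is the first (smallest) eigenvalue of the Robin problem $$\Delta u+\mu_1(k)u=0\ \text{ on }\Omega,\qquad \frac{\partial u}{\partial n}+ku=0\ \text{ on }\delta\Omega,$$ that is, the smallest real number for which this problem has a solution $u:\overline{\Omega}\to\mathbb{R}$, $u\not\equiv0$.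
   Context: $V$ is a finite set and $\mu:V\times V\to[0,\infty)$, $(x,y)\mapsto\mu_{xy}=\mu_{yx}$, is a symmetric weight function; $\{x,y\}\in E$ (written $x\sim y$) iff $\mu_{xy}>0$. Self-loops are allowed. For $\Omega_1,\Omega_2\subset V$, $E(\Omega_1,\Omega_2)=\{\{x,y\}\in E: x\in\Omega_1,y\in\Omega_2\}$. For $F\subset E$, $\mu(F)=\sum_{\{x,y\}\in F}\mu_{xy}$. The vertex boundary is $\delta\Omega=\{x\in V\setminus\Omega: x\sim y\text{ for some }y\in\Omega\}$, and $\overline{\Omega}=\Omega\cup\delta\Omega$. The graph $\widetilde{\Omega}$ has vertex set $\overline{\Omega}$ and edge set $E(\Omega,\overline{\Omega})$. The measure $m:\overline{\Omega}\to(0,\infty)$ is $m_x=\sum_{y\in V,\,y\sim x}\mu_{xy}$ for $x\in\Omega$ and $m_x=\sum_{y\in\Omega,\,y\sim x}\mu_{xy}$ for $x\in\delta\Omega$; $m(A)=\sum_{x\in A}m_x$. For $f:\overline{\Omega}\to\mathbb{R}$: $\Delta f(x)=\frac1{m_x}\sum_{y\sim x}\mu_{xy}(f(y)-f(x))$ for $x\in\Omega$, and $\frac{\partial f}{\partial n}(z)=\frac1{m_z}\sum_{x\in\Omega,\,x\sim z}\mu_{zx}(f(z)-f(x))$ for $z\in\delta\Omega$. For $\varphi:\delta\Omega\to\mathbb{R}$, $u_\varphi:\overline{\Omega}\to\mathbb{R}$ is the unique function with $\Delta u_\varphi=0$ on $\Omega$ and $u_\varphi=\varphi$ on $\delta\Omega$.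 The Dirichlet-to-Neumann operator is $\Lambda:\mathbb{R}^{\delta\Omega}\to\mathbb{R}^{\delta\Omega}$, $\Lambda\varphi=\frac{\partial u_\varphi}{\partial n}$; it is self-adjoint and nonnegative for $\langle\varphi,\psi\rangle_{\delta\Omega}=\sum_{x\in\delta\Omega}\varphi(x)\psi(x)m_x$, with eigenvalues $0=\lambda_0(\Omega)<\lambda_1(\Omega)\le\cdots$ listed with multiplicity. For $A\subset\overline{\Omega}$, $\partial_\Omega A=E(A,V\setminus A)\cap E(\Omega,\overline{\Omega})$. The Escobar-type Cheeger constant is $$h_E(\widetilde{\Omega})=\inf\left\{\frac{\mu(\partial_\Omega A)}{m(A\cap\delta\Omega)}: A\subset\overline{\Omega},\ 0<m(A\cap\delta\Omega)\le\tfrac12 m(\delta\Omega)\right\}.$$ *)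

(* Defs.v *)
From HB Require Import structures.
From mathcomp Require Import all_boot all_order all_algebra.
From mathcomp Require Import boolp classical_sets reals.

Set Implicit Arguments.
Unset Strict Implicit.
Unset Printing Implicit Defensive.

Import Order.TTheory GRing.Theory Num.Theory.
Local Open Scope ring_scope.

Section WeightedGraph.
Variables (R : realType) (V : finType) (mu : V -> V -> R).

Definition adj : rel V := fun x y => 0 < mu x y.

(* An edge is the unordered pair [set x; y]; a self-loop is a singleton. *)
Definition edges (A B : {set V}) : {set {set V}} :=
  ([set [set p.1; p.2] | p in [set p : V * V |
      [&& p.1 \in A, p.2 \in B & adj p.1 p.2]]])%SET.

(* Symmetry of mu makes this independent of the orientation that is picked. *)
Definition edge_weight (e : {set V}) : R :=
  if [pick p : V * V | e == [set p.1; p.2]%SET] is Some p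
  then mu p.1 p.2 else 0.

Definition weight (F : {set {set V}}) : R := \sum_(e in F) edge_weight e.

Section Domain.
Variable Omega : {set V}.

Definition vbdry : {set V} :=
  [set x in ~: Omega | [exists y in Omega, adj x y]]%SET.

Definition vclosure : {set V} := Omega :|: vbdry.

(* The edge set of the graph induced on vclosure; edges joining two boundary
   vertices are discarded. *)
Definition tedges : {set {set V}} := edges Omega vclosure.

Definition tadj : rel V := fun x y => [set x; y]%SET \in tedges.

Definition tconnected : Prop := {in vclosure &, forall x y, connect tadj x y}.

(* Meaningful for x in vclosure only. *)
Definition vm (x : V) : R :=
  if x \in Omega then \sum_(y | adj y x) mu x y
  else \sum_(y in Omega | adj y x) mu x y.

Definition meas (A : {set V}) : R := \sum_(x in A) vm x.

(* Functions on vclosure are represented by functions on V: the operators below,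
   at x in Omega and z in vbdry, only read values at points of vclosure. *)
Definition laplacian (f : V -> R) (x : V) : R :=
  (vm x)^-1 * \sum_(y | adj y x) mu x y * (f y - f x).

Definition normal_deriv (f : V -> R) (z : V) : R :=
  (vm z)^-1 * \sum_(x in Omega | adj x z) mu z x * (f z - f x).

Definition bvertex : finType := {x : V | x \in vbdry}.

Definition bfun := {ffun bvertex -> R^o}.

(* Vanishing off vclosure only pins down the irrelevant values. *)
Definition is_harmonic_ext (phi : bfun) (u : V -> R) : Prop :=
  [/\ {in Omega, forall x, laplacian u x = 0},
      forall z : bvertex, u (val z) = phi z
    & forall x, x \notin vclosure -> u x = 0].

Definition harmonic_ext (phi : bfun) : {ffun V -> R} :=
  xget [ffun=> 0] [set u : {ffun V -> R} | is_harmonic_ext phi u]%classic.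

Definition DtN (phi : bfun) : bfun :=
  [ffun z : bvertex => normal_deriv (harmonic_ext phi) (val z)].

(* DtN is linear as soon as harmonic extensions exist and are unique; linfun
   then repackages it, unchanged, as an endomorphism of the space bfun. *)
Definition DtN_op : 'End(bfun) := linfun DtN.

(* s enumerates the eigenvalues of L in nondecreasing order, each one repeated
   as many times as the dimension of its eigenspace. *)
Definition is_spectrum (vT : vectType R) (L : 'End(vT)) (s : seq R) : Prop :=
  sorted <=%R s /\ forall l : R, count_mem l s = \dim (passmx.leigenspace L l).

Definition spectrum (vT : vectType R) (L : 'End(vT)) : seq R :=
  xget [::] [set s | is_spectrum L s]%classic.

Definition DtN_eigenvalue (j : nat) : R := (spectrum DtN_op)`_j.

Definition tbdry (A : {set V}) : {set {set V}} := edges A (~: A) :&: tedges.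

Definition escobar_cheeger : R :=
  inf [set r : R | exists A : {set V},
    [/\ A \subset vclosure,
        0 < meas (A :&: vbdry),
        meas (A :&: vbdry) <= 2^-1 * meas vbdry
      & r = weight (tbdry A) / meas (A :&: vbdry)]]%classic.

Definition is_robin_eigenvalue (k l : R) : Prop :=
  exists u : V -> R,
    [/\ exists2 x, x \in vclosure & u x != 0,
        {in Omega, forall x, laplacian u x + l * u x = 0}
      & {in vbdry, forall z, normal_deriv u z + k * u z = 0}].

Definition robin_eigenvalue1 (k : R) : R :=
  xget 0 [set l | is_robin_eigenvalue k l /\
                  forall l', is_robin_eigenvalue k l' -> l <= l']%classic.

End Domain.
End WeightedGraph.

(* Main.v *)
(* Let u be a Steklov eigenfunction for lambda_1 and g its positive part; up to
   the sign of u, g charges at most half of the boundary. Put E for the Dirichlet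
   energy of g, and M and B for the integrals of g^2 over Omega and over its
   boundary. Then E <= lambda_1 B, the variational characterization of the Robin
   eigenvalue gives mu_1 M <= E + k B, and the discrete coarea formula gives
   h B <= sum over edges of mu_xy |g(x)^2 - g(y)^2| <= E / a + (a / 2) (M + B),
   the last step by AM-GM. Eliminating M yields the bound.
   Both the Robin eigenvalue and the existence of a second Steklov eigenvalue come
   from maximizing a quotient of two quadratic forms on all of V. *)
From HB Require Import structures.
Require Import Defs.
From mathcomp Require Import all_boot all_order all_algebra polyrcf.
From mathcomp Require Import boolp classical_sets reals.
From mathcomp Require Import functions topology normedtype derive.
From mathcomp Require Import ring lra.

Set Implicit Arguments.
Unset Strict Implicit.
Unset Printing Implicit Defensive.

Import Order.TTheory GRing.Theory Num.Theory.
Import numFieldNormedType.Exports.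
Local Open Scope ring_scope.

(** The estimate holds for every nonzero Steklov eigenvalue, because E <= lambda B comes from
    testing an eigenfunction against its own positive part. What has to be established about
    [DtN_eigenvalue] is therefore that its entry of index 1 is a nonzero eigenvalue: 0 is simple and
    some other eigenvalue exists. The quotients are taken upside down. The integrals of u^2 over
    Omega or over the boundary are degenerate forms and cannot serve as denominators, whereas the
    energy becomes definite on the closure, by connectedness, once a boundary term is added: k B for
    Robin, the squared boundary integral for Steklov. With this form as denominator a maximum exists
    on a compact sphere, and its reciprocal is the eigenvalue. *)

Section Rayleigh.
Variables (R : realType) (T : finType).
Local Notation U := {ffun T -> R^o}.

(** * Maximizing a quotient of two quadratic forms *)

Definition sym_bilinear (b : U -> U -> R) : Prop :=
  (forall u v, b u v = b v u) /\ forall v, scalar (b^~ v).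

Definition dirac (x : T) : U := [ffun y => (x == y)%:R].

Lemma ffun_diracE (u : U) : u = \sum_x u x *: dirac x.
Proof.
apply/ffunP => y; rewrite sum_ffunE (bigD1 y) //= !ffunE eqxx.
rewrite big1 => [|x /negbTE neq]; first by rewrite addr0 /GRing.scale /= mulr1.
by rewrite !ffunE neq scaler0.
Qed.

Variables (S P : U -> U -> R).
Hypotheses (bS : sym_bilinear S) (bP : sym_bilinear P).

Lemma sym_bilinear_suml (b : U -> U -> R) (I : Type) (r : seq I)
    (c : I -> R) (F : I -> U) v : sym_bilinear b ->
  b (\sum_(i <- r) c i *: F i) v = \sum_(i <- r) c i * b (F i) v.
Proof.
case=> _ bl; have b0 : b 0 v = 0.
  by have := bl v (-1) 0 0; rewrite scaler0 addr0 mulN1r addNr.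
by elim/big_rec2: _ => // i y1 y2 _ <-; apply: bl.
Qed.

Lemma sym_bilinearE (b : U -> U -> R) u v : sym_bilinear b ->
  b u v = \sum_x \sum_y u x * v y * b (dirac x) (dirac y).
Proof.
move=> bb; rewrite {1}(ffun_diracE u) sym_bilinear_suml //.
apply: eq_bigr => x _; rewrite bb.1 {1}(ffun_diracE v) sym_bilinear_suml //.
by rewrite mulr_sumr; apply: eq_bigr => y _; rewrite bb.1; ring.
Qed.

Lemma sym_bilinear_quadD (b : U -> U -> R) u v t : sym_bilinear b ->
  b (t *: v + u) (t *: v + u) = b u u + t * (2 * b u v) + t ^+ 2 * b v v.
Proof.
move=> [bs bl]; rewrite (bl _ t v u) !(bs _ (t *: v + u)) !bl (bs v u); ring.
Qed.

(** Along [t *: v + u] the form is a nonnegative polynomial in [t] of degree at most 2 without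
    constant term, so its linear coefficient vanishes; if [b v v] is positive, this is read off at
    the minimizer [- b u v / b v v]. *)
Lemma sym_bilinear_psd_kernel (b : U -> U -> R) u v : sym_bilinear b ->
  (forall w, 0 <= b w w) -> b u u = 0 -> b u v = 0.
Proof.
move=> bb pos u0; have key t : 0 <= t * (2 * b u v) + t ^+ 2 * b v v.
  by have := pos (t *: v + u); rewrite sym_bilinear_quadD // u0 add0r.
have [v0|v_neq0] := eqVneq (b v v) 0.
  by have := key 1; have := key (-1); rewrite v0; lra.
have v_gt0 : 0 < b v v by rewrite lt_def v_neq0 pos.
have := key (- b u v / b v v).
have -> : - b u v / b v v * (2 * b u v) + (- b u v / b v v) ^+ 2 * b v v =
  - ((b u v) ^+ 2 / b v v) by field.
rewrite oppr_ge0 pmulr_lle0 ?invr_gt0 // => le0.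
by apply/eqP; rewrite -sqrf_eq0 eq_le le0 sqr_ge0.
Qed.

(* The maximum of S/P over a compact sphere is attained at u; then l P - S is
   positive semidefinite and vanishes at u, so u lies in its kernel. *)
Lemma rayleigh_max : (0 < #|T|)%N -> (forall u, u != 0 -> 0 < P u u) ->
  exists u l, [/\ u != 0, forall v, S u v = l * P u v
                & forall v, S v v <= l * P v v].
Proof.
move=> T_gt0 Ppos.
(* Compactness and continuity are handled on row vectors, identified with functions by enumerating
   [T]. *)
pose U_of (w : 'rV[R]_#|T|) : U := [ffun x => w ord0 (enum_rank x)].
pose rV_of (u : U) : 'rV[R]_#|T| := \row_i u (enum_val i).
have rV_ofK u : U_of (rV_of u) = u.
  by apply/ffunP => x; rewrite ffunE mxE enum_rankK.
have U_ofZ c w : U_of (c *: w) = c *: U_of w.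
  by apply/ffunP => x; rewrite !ffunE mxE.
have U_of_eq0 w : U_of w = 0 -> w = 0.
  move=> w0; apply/rowP => i; rewrite mxE.
  by have := congr1 (fun u : U => u (enum_val i)) w0; rewrite !ffunE enum_valK.
have cont b : sym_bilinear b -> continuous (fun w => b (U_of w) (U_of w)).
  move=> bb; have -> : (fun w => b (U_of w) (U_of w)) = \sum_x \sum_y
      (fun w : 'rV[R]_#|T| => w ord0 (enum_rank x) * w ord0 (enum_rank y) *
                b (dirac x) (dirac y) : R).
    apply/funext => w; rewrite sym_bilinearE // fct_sumE; apply: eq_bigr => x _.
    by rewrite fct_sumE; apply: eq_bigr => y _; rewrite !ffunE.
  elim/big_rec: _ => [w|x f _ cf w]; first exact: (@cst_continuous _ _ (0 : R)).
  apply: cvgD (cf w).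
  elim/big_rec: _ => [|y g _ cg]; first exact: (@cst_continuous _ _ (0 : R)).
  apply: cvgD cg.
  by apply: cvgM (cvg_cst _); apply: cvgM; exact: coord_continuous.
pose sphere : set 'rV[R]_#|T| := [set w | `|w| = 1]%classic.
have sphere_compact : compact sphere.
  apply: bounded_closed_compact.
    exists 1; split=> [|M M1 w]; [exact: real1|rewrite /sphere /= => ->; exact: ltW].
  have /continuous_closedP := @norm_continuous R 'rV[R]_#|T|.
  by move=> /(_ [set x | x = 1]%classic (@closed_eq R 1)).
have normalize w : w != 0 -> sphere (`|w|^-1 *: w).
  move=> w0; rewrite /sphere /= normrZ normfV normr_id mulVf //.
  by rewrite normr_eq0.
have sphere_neq0 w : sphere w -> U_of w != 0.
  move=> w1; apply: contraPneq w1 => /U_of_eq0 ->.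
  by rewrite /sphere /= normr0; apply/eqP; rewrite eq_sym oner_neq0.
pose ratio w := S (U_of w) (U_of w) / P (U_of w) (U_of w).
have [||w] := @compact_EVT_max _ R ratio sphere _ sphere_compact _.
- exists (`|rV_of [ffun=> 1]|^-1 *: rV_of [ffun=> 1]); apply: normalize.
  have /card_gt0P[x _] := T_gt0.
  apply/eqP => /rowP/(_ (enum_rank x)); rewrite !mxE ffunE.
  by apply/eqP; rewrite oner_neq0.
- apply: continuous_in_subspaceT => w; rewrite inE => w1.
  apply: (cvgM (cont _ bS w) (cvgV _ (cont _ bP w))).
  by rewrite gt_eqF // Ppos // sphere_neq0.
rewrite inE => w1 wmax.
have u_neq0 : U_of w != 0 by exact: sphere_neq0.
have Pu_gt0 := Ppos _ u_neq0.
exists (U_of w), (ratio w).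
(* Both forms are homogeneous of degree 2, so the bound on the sphere extends to every nonzero [v]
   by normalizing. *)
have Sle v : S v v <= ratio w * P v v.
  have [->|v0] := eqVneq v 0.
    by rewrite !(sym_bilinearE _ _ bS, sym_bilinearE _ _ bP) !big1 ?mulr0 // => x _;
      rewrite big1 // => y _; rewrite !ffunE !mul0r.
  have r0 : rV_of v != 0.
    by apply: contra_neq v0 => v0; rewrite -(rV_ofK v) v0;
       apply/ffunP => x; rewrite !ffunE mxE.
  have /wmax : `|rV_of v|^-1 *: rV_of v \in sphere by rewrite inE; exact: normalize.
  rewrite {1}/ratio U_ofZ rV_ofK -[_ *: v]addr0.
  have quadZ b t : sym_bilinear b -> b (t *: v + 0) (t *: v + 0) = t ^+ 2 * b v v.
    move=> bb; rewrite sym_bilinear_quadD //.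
    have z0 u : b 0 u = 0.
      by rewrite sym_bilinearE // big1 // => x _; rewrite big1 // => y _;
         rewrite ffunE !mul0r.
    by rewrite !z0; ring.
  rewrite !quadZ // invfM mulrACA divff ?mul1r ?ler_pdivrMr //; first exact: Ppos.
  by rewrite sqrf_eq0 invr_eq0 normr_eq0.
split => // v.
pose D u v := ratio w * P u v - S u v.
have bD : sym_bilinear D.
  split=> [u1 u2|u2 t u1 u1']; first by rewrite /D bS.1 bP.1.
  by rewrite /D bS.2 bP.2; ring.
apply/eqP; rewrite eq_sym -subr_eq0; apply/eqP.
apply: (sym_bilinear_psd_kernel v bD) => [u|]; first by rewrite subr_ge0.
by rewrite /D /ratio divfK ?subrr // gt_eqF.
Qed.
End Rayleigh.

(** * Spectra of endomorphisms *)

Lemma mem_leigenspace (F : fieldType) (W : vectType F) (L : 'End(W)) l v :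
  (v \in passmx.leigenspace L l) = (L v == l *: v).
Proof.
by rewrite memv_ker add_lfunE opp_lfunE scale_lfunE id_lfunE subr_eq0.
Qed.

Lemma leigenvalues_finite (R : rcfType) (W : vectType R) (L : 'End(W)) :
  exists2 rs : seq R, uniq rs &
    forall l, passmx.leigenspace L l != 0%VS -> l \in rs.
Proof.
pose A := passmx.mxof (vbasis {:W}) (vbasis {:W}) L.
have p_neq0 : char_poly A != 0 by rewrite monic_neq0 ?char_poly_monic.
exists (rootsR (char_poly A)) => [|l].
  exact: sorted_uniq lt_trans (@lt_irreflexive _ _) _ (sorted_roots _ _ _).
have vb := vbasisP {:W}; rewrite (passmx.leigenspaceE vb) (passmx.vsof_eq0 vb).
have := roots_on_rootsR p_neq0 l; rewrite in_itv /= => <-.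
by rewrite -eigenvalue_root_char.
Qed.

(** Each candidate from a finite list containing all eigenvalues is repeated as often as the
    dimension of its eigenspace, then the list is sorted; a candidate that is not an eigenvalue is
    repeated zero times. *)
Lemma spectrum_exists (R : realType) (W : vectType R) (L : 'End(W)) :
  exists s, is_spectrum L s.
Proof.
have [rs rs_uniq rsP] := leigenvalues_finite L.
pose d l := \dim (passmx.leigenspace L l).
exists (sort <=%R (flatten [seq nseq (d l) l | l <- rs])); split.
  exact: sort_sorted (@le_total _ R) _.
move=> l; have /permP -> : perm_eq (sort <=%R (flatten [seq nseq (d l) l | l <- rs]))
  (flatten [seq nseq (d l) l | l <- rs]) by rewrite perm_sort.
transitivity ((l \in rs) * d l)%N; last first.
  case: (boolP (l \in rs)) => [_|]; first by rewrite mul1n.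
  by apply: contraNeq; rewrite mul0n eq_sym dimv_eq0; exact: rsP.
elim: rs rs_uniq {rsP} => //= r rs IH /andP[r_rs /IH]; rewrite count_cat count_nseq => ->.
rewrite in_cons /= [r == l]eq_sym; have [->|_] := eqVneq l r; last by rewrite mul0n.
by rewrite (negbTE r_rs) mul0n addn0.
Qed.

Lemma spectrumP (R : realType) (W : vectType R) (L : 'End(W)) :
  is_spectrum L (spectrum L).
Proof.
rewrite /spectrum; case: xgetP => [s _ //|none].
by have [s /none] := spectrum_exists L.
Qed.

(** * Energy and Green's formula on the closure *)

Section Domain.
Variables (R : realType) (V : finType) (mu : V -> V -> R) (Omega : {set V}).
Hypotheses (mu_sym : forall x y, mu x y = mu y x)
  (mu_ge0 : forall x y, 0 <= mu x y).

Local Notation bdry := (vbdry mu Omega).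
Local Notation clos := (vclosure mu Omega).
Local Notation m := (vm mu Omega).

(* Vanishes when one end is off the closure, so vm and Green's formula become
   plain sums over V. *)
Definition tweight (x y : V) : R :=
  if (x \in Omega) || (y \in Omega) then mu x y else 0.
Local Notation w := tweight.

Lemma tweight_sym x y : w x y = w y x.
Proof. by rewrite /w orbC mu_sym. Qed.

Lemma tweight_ge0 x y : 0 <= w x y.
Proof. by rewrite /w; case: ifP. Qed.

Lemma not_adj_mu x y : ~~ adj mu y x -> mu x y = 0.
Proof.
by rewrite /adj -leNgt mu_sym => le0; apply/eqP; rewrite eq_le le0 mu_ge0.
Qed.

Lemma bdry_notin x : x \in bdry -> x \notin Omega.
Proof. by rewrite inE finset.in_setC => /andP[]. Qed.

Lemma in_closure x : (x \in clos) = (x \in Omega) || (x \in bdry).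
Proof. by rewrite finset.in_setU. Qed.

Lemma adj_in_closure x y : y \in Omega -> adj mu x y -> x \in clos.
Proof.
move=> yO xy; rewrite in_closure; case: (boolP (x \in Omega)) => //= xO.
by rewrite inE finset.in_setC xO; apply/existsP; exists y; rewrite yO.
Qed.

Lemma tweight_off x y : x \notin clos -> w x y = 0.
Proof.
move=> xD; rewrite /w; case: (boolP (x \in Omega)) => [xO|xO /=].
  by rewrite in_closure xO in xD.
case: ifP => // yO; apply: not_adj_mu; apply: contra xD.
by rewrite /adj mu_sym; apply: adj_in_closure.
Qed.

Lemma tweightE x y : tadj mu Omega x y = (0 < w x y).
Proof.
apply/imsetP/idP => [[[p q]] /=|w_gt0].
  rewrite !inE /= => /and3P[pO qD pq] xy.
  have [[-> ->]|[-> ->]] : (x = p /\ y = q) \/ (x = q /\ y = p).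
    have : x \in [set p; q]%SET by rewrite -xy !inE eqxx.
    have : y \in [set p; q]%SET by rewrite -xy !inE eqxx orbT.
    have : p \in [set x; y]%SET by rewrite xy !inE eqxx.
    have : q \in [set x; y]%SET by rewrite xy !inE eqxx orbT.
    by rewrite !inE => /orP[]/eqP -> /orP[]/eqP -> /orP[]/eqP ? /orP[]/eqP ?;
       subst; tauto.
  - by rewrite /w pO.
  - by rewrite /w pO orbT mu_sym.
have: adj mu x y by move: w_gt0; rewrite /w /adj; case: ifP; rewrite ?ltxx.
move=> xy; have yx : adj mu y x by rewrite /adj mu_sym.
move: w_gt0; rewrite /w; case: ifP; rewrite ?ltxx // => /orP[xO|yO] _.
  by exists (x, y) => //; rewrite inE /= xO xy andbT; exact: adj_in_closure xO yx.
exists (y, x) => /=; last by rewrite finset.setUC.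
by rewrite inE /= yO yx andbT; exact: adj_in_closure yO xy.
Qed.

Lemma vmE x : m x = \sum_y w x y.
Proof.
rewrite /vm /w; case: ifP => xO /=; rewrite big_mkcond; apply: eq_bigr => y _.
  by case: ifPn => // /not_adj_mu.
by case: (y \in Omega) => //=; case: ifPn => // /not_adj_mu.
Qed.

(** This is [m x] times minus the Laplacian in [Omega], and [m x] times the normal derivative on the
    boundary, so that one sum carries both terms of Green's formula. *)
Definition outflow (u : V -> R) (x : V) : R := \sum_y w x y * (u x - u y).

Lemma laplacianE (u : V -> R) x : x \in Omega ->
  laplacian mu Omega u x = - ((m x)^-1 * outflow u x).
Proof.
move=> xO; rewrite /laplacian -mulrN; congr (_ * _).
rewrite /outflow -sumrN big_mkcond; apply: eq_bigr => y _.
rewrite /w xO /=; case: ifPn => [_|/not_adj_mu ->]; ring.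
Qed.

Lemma normal_derivE (u : V -> R) z : z \in bdry ->
  normal_deriv mu Omega u z = (m z)^-1 * outflow u z.
Proof.
move=> /bdry_notin/negbTE zO; rewrite /normal_deriv; congr (_ * _).
rewrite /outflow big_mkcond; apply: eq_bigr => y _; rewrite /w zO.
case: (y \in Omega) => /=; last by rewrite mul0r.
by case: ifPn => // /not_adj_mu ->; rewrite mul0r.
Qed.

Definition energy (u v : V -> R) : R :=
  2^-1 * \sum_x \sum_y w x y * ((u x - u y) * (v x - v y)).

(** Exchanging the two indices turns the part with [v y] into minus the part with [v x], so the two
    halves add up and absorb the factor 1/2. *)
Lemma green (u v : V -> R) : energy u v = \sum_x v x * outflow u x.
Proof.
have swap : \sum_x \sum_y w x y * ((u x - u y) * v y) =
    - \sum_x \sum_y w x y * ((u x - u y) * v x).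
  rewrite exchange_big -sumrN; apply: eq_bigr => x _; rewrite -sumrN.
  by apply: eq_bigr => y _; rewrite tweight_sym; ring.
have split : energy u v = 2^-1 * (\sum_x \sum_y w x y * ((u x - u y) * v x) -
    \sum_x \sum_y w x y * ((u x - u y) * v y)).
  congr (_ * _); rewrite -sumrB; apply: eq_bigr => x _; rewrite -sumrB.
  by apply: eq_bigr => y _; ring.
have -> : \sum_x v x * outflow u x =
    \sum_x \sum_y w x y * ((u x - u y) * v x).
  by apply: eq_bigr => x _; rewrite mulr_sumr; apply: eq_bigr => y _; ring.
by rewrite split swap; field.
Qed.

Lemma energy_ge0 (u : V -> R) : 0 <= energy u u.
Proof.
rewrite mulr_ge0 ?invr_ge0 ?ler0n // sumr_ge0 // => x _; rewrite sumr_ge0 // => y _.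
by rewrite mulr_ge0 ?tweight_ge0 // -expr2 sqr_ge0.
Qed.

Lemma energy_sym (u v : V -> R) : energy u v = energy v u.
Proof.
congr (_ * _); apply: eq_bigr => x _; apply: eq_bigr => y _; ring.
Qed.

Lemma energy_bilinear : sym_bilinear (fun u v : {ffun V -> R^o} => energy u v).
Proof.
split=> [u v|v a u u']; first exact: energy_sym.
rewrite /energy mulrCA -mulrDr; congr (_ * _); rewrite mulr_sumr -big_split.
apply: eq_bigr => x _; rewrite mulr_sumr -big_split; apply: eq_bigr => y _.
by rewrite /= !ffunE /GRing.scale /=; ring.
Qed.

Definition wform (c u v : V -> R) : R := \sum_x c x * (u x * v x).

Lemma wform_bilinear (c : V -> R) :
  sym_bilinear (fun u v : {ffun V -> R^o} => wform c u v).
Proof.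
split=> [u v|v a u u'].
  by apply: eq_bigr => x _; rewrite [u x * _]mulrC.
rewrite /wform mulr_sumr -big_split; apply: eq_bigr => x _.
by rewrite /= !ffunE /GRing.scale /=; ring.
Qed.

Lemma wform_ge0 (c u : V -> R) : (forall x, 0 <= c x) -> 0 <= wform c u u.
Proof.
by move=> c0; rewrite sumr_ge0 // => x _; rewrite mulr_ge0 // -expr2 sqr_ge0.
Qed.

Lemma wform_eq0 (c u : V -> R) x : (forall x, 0 <= c x) -> wform c u u = 0 ->
  0 < c x -> u x = 0.
Proof.
move=> c0 /eqP; rewrite psumr_eq0 => [|y _]; last first.
  by rewrite mulr_ge0 // -expr2 sqr_ge0.
move=> /allP/(_ x); rewrite mem_index_enum => /(_ isT).
rewrite implyTb mulf_eq0 => /orP[/eqP->|]; first by rewrite ltxx.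
by rewrite -expr2 sqrf_eq0 => /eqP.
Qed.

(** Testing an identity of forms against [dirac] recovers the equation at one vertex; this is how a
    maximizer becomes a solution of a boundary value problem. *)
Lemma energy_dirac (u : V -> R) x : energy u (dirac R x) = outflow u x.
Proof.
rewrite green (bigD1 x) //= !ffunE eqxx mul1r big1 ?addr0 // => y /negbTE yx.
by rewrite ffunE eq_sym yx mul0r.
Qed.

Lemma wform_dirac (c u : V -> R) x : wform c u (dirac R x) = c x * u x.
Proof.
rewrite /wform (bigD1 x) //= !ffunE eqxx mulr1 big1 ?addr0 // => y /negbTE yx.
by rewrite ffunE eq_sym yx !mulr0.
Qed.

Definition restr (A : {set V}) (c : V -> R) (x : V) : R :=
  if x \in A then c x else 0.

Lemma outflow_eq (u v : V -> R) x : {in clos, u =1 v} -> x \in clos ->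
  outflow u x = outflow v x.
Proof.
move=> uv xD; apply: eq_bigr => y _; rewrite uv //.
have [/uv ->//|yD] := boolP (y \in clos).
by rewrite tweight_sym tweight_off // !mul0r.
Qed.

Lemma outflow_off (u : V -> R) x : x \notin clos -> outflow u x = 0.
Proof. by move=> xD; rewrite /outflow big1 // => y _; rewrite tweight_off ?mul0r. Qed.

(** * Definiteness from connectedness *)

Hypotheses (conn : tconnected mu Omega) (bdry_ge2 : (2 <= #|bdry|)%N).

Lemma energy_eq0 (u : V -> R) : energy u u = 0 ->
  {in clos &, forall x y, u x = u y}.
Proof.
move=> /eqP; rewrite mulf_eq0 invr_eq0 pnatr_eq0 /= psumr_eq0 => [/allP e0|x _]; last first.
  by rewrite sumr_ge0 // => y _; rewrite mulr_ge0 ?tweight_ge0 // -expr2 sqr_ge0.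
have step x y : tadj mu Omega x y -> u x = u y.
  rewrite tweightE => wxy; have := e0 x; rewrite mem_index_enum => /(_ isT).
  rewrite psumr_eq0 => [/allP/(_ y)|z _]; last first.
    by rewrite mulr_ge0 ?tweight_ge0 // -expr2 sqr_ge0.
  rewrite mem_index_enum => /(_ isT); rewrite !implyTb mulf_eq0 gt_eqF //=.
  by rewrite -expr2 sqrf_eq0 subr_eq0 => /eqP.
move=> x y xD yD; have /connectP[p xp ->] := conn xD yD.
by elim: p x {xD} xp => //= z p IH x /andP[/step -> /IH].
Qed.

(** Some boundary vertex differs from [x], and the first step of a path towards it is an edge of
    positive weight at [x]. *)
Lemma vm_gt0 x : x \in clos -> 0 < m x.
Proof.
move=> xD; have [z zB zx] : exists2 z, z \in bdry & z != x.
  apply: contraTP bdry_ge2 => bx; rewrite -ltnNge ltnS.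
  rewrite -(cards1 x) subset_leq_card //; apply/fintype.subsetP => z zB.
  by rewrite inE; apply: contra_notT bx => zx; exists z.
have zD : z \in clos by rewrite in_closure zB orbT.
have /connectP[[|y p] /= xp zE] := conn xD zD; first by rewrite zE eqxx in zx.
move: xp => /andP[]; rewrite tweightE => wxy _.
rewrite vmE (bigD1 y) //= ltr_pwDl // sumr_ge0 // => ? _; exact: tweight_ge0.
Qed.

Lemma vm_ge0 x : 0 <= m x.
Proof. by rewrite vmE sumr_ge0 // => y _; exact: tweight_ge0. Qed.

Lemma restr_vm_ge0 (A : {set V}) x : 0 <= restr A m x.
Proof. by rewrite /restr; case: ifP => // _; exact: vm_ge0. Qed.

Lemma bdry_ex : exists z, z \in bdry.
Proof. by apply/card_gt0P; apply: leq_trans bdry_ge2. Qed.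


Local Notation U := {ffun V -> R^o}.

Lemma bdry_in_closure z : z \in bdry -> z \in clos.
Proof. by move=> zB; rewrite in_closure zB orbT. Qed.

(* Its form penalizes the junk values off the closure, making the Robin and
   Steklov forms definite on all of V. *)
Definition off (x : V) : R := (x \notin clos)%:R.

Lemma off_ge0 x : 0 <= off x.
Proof. exact: ler0n. Qed.

Lemma off_out x : x \notin clos -> off x = 1.
Proof. by rewrite /off => ->. Qed.

Lemma off_in x : x \in clos -> off x = 0.
Proof. by rewrite /off => ->. Qed.

Lemma posdef_of_bdry (u : U) z : z \in bdry -> u z = 0 -> energy u u = 0 ->
  wform off u u = 0 -> u = 0.
Proof.
move=> zB uz /energy_eq0 ue uo; apply/ffunP => x; rewrite ffunE.
have [xD|xD] := boolP (x \in clos); first by rewrite (ue x z) // bdry_in_closure.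
by apply: (wform_eq0 off_ge0 uo); rewrite off_out.
Qed.

(** * The first Robin eigenvalue *)

Section Robin.
Variable k : R.
Hypotheses (k_gt0 : 0 < k) (Omega_neq0 : Omega != finset.set0).

Definition robin_form (u v : V -> R) : R :=
  energy u v + k * wform (restr bdry m) u v + wform off u v.

Lemma robin_form_ge0 (u : V -> R) : 0 <= robin_form u u.
Proof.
apply: addr_ge0 (wform_ge0 _ off_ge0); apply: addr_ge0 (energy_ge0 u) _.
apply: mulr_ge0 (ltW k_gt0) (wform_ge0 _ _) => x; exact: restr_vm_ge0.
Qed.

Lemma robin_form_gt0 (u : U) : u != 0 -> 0 < robin_form u u.
Proof.
rewrite lt_def robin_form_ge0 andbT; apply: contra_neq.
have B0 : 0 <= wform (restr bdry m) u u by apply: wform_ge0; exact: restr_vm_ge0.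
have o0 := wform_ge0 u off_ge0; have e0 := energy_ge0 u.
have kB0 : 0 <= k * wform (restr bdry m) u u by rewrite mulr_ge0 // ltW.
rewrite /robin_form => sum0.
have [z zB] := bdry_ex; apply: (posdef_of_bdry zB) => //; try lra.
have /eqP : k * wform (restr bdry m) u u = 0 by lra.
rewrite mulf_eq0 gt_eqF //= => /eqP /(wform_eq0 (@restr_vm_ge0 bdry)); apply.
by rewrite /restr zB vm_gt0 // bdry_in_closure.
Qed.

Lemma robin_form_bilinear : sym_bilinear (fun u v : U => robin_form u v).
Proof.
have [eS eB] := energy_bilinear; have [bS bB] := wform_bilinear (restr bdry m).
have [oS oB] := wform_bilinear off.
split=> [u v|v a u u']; rewrite /robin_form; first by rewrite eS bS oS.
by rewrite eB bB oB; ring.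
Qed.

Lemma robin_form_dirac (u : V -> R) x :
  robin_form u (dirac R x) = outflow u x + k * (restr bdry m x * u x) + off x * u x.
Proof. by rewrite /robin_form energy_dirac !wform_dirac. Qed.

(** Multiplication by [m x] merges the two equations, since at each vertex of the closure exactly
    one of the two restricted weights is nonzero. *)
Lemma robin_outflowE (l : R) (u : V -> R) :
  {in Omega, forall x, laplacian mu Omega u x + l * u x = 0} ->
  {in bdry, forall z, normal_deriv mu Omega u z + k * u z = 0} ->
  forall x, x \in clos ->
  outflow u x + k * (restr bdry m x * u x) = l * (restr Omega m x * u x).
Proof.
move=> uO uB x xD; have mx := lt0r_neq0 (vm_gt0 xD).
move: (xD); rewrite /restr in_closure; case: (boolP (x \in bdry)) => [xB _|xB].
  rewrite (negbTE (bdry_notin xB)); have := uB x xB; rewrite normal_derivE //.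
  move=> /(congr1 ( *%R (m x))); rewrite mulrDr mulVKf // mulr0 => h.
  lra.
rewrite orbF => xO; rewrite xO; have := uO x xO; rewrite laplacianE //.
move=> /(congr1 ( *%R (m x))); rewrite mulrDr mulrN mulVKf // mulr0.
move=> h; rewrite mul0r mulr0 addr0; lra.
Qed.

(** The maximum [l] of the mass on [Omega] over [robin_form] gives the eigenvalue [l^-1]. It is the
    smallest because any other eigenfunction is a competitor in the same maximization. *)
Lemma robin_eigenvalue1P : 0 < robin_eigenvalue1 mu Omega k /\
  forall g : V -> R, {in ~: clos, forall x, g x = 0} ->
    robin_eigenvalue1 mu Omega k * wform (restr Omega m) g g <=
    energy g g + k * wform (restr bdry m) g g.
Proof.
have [x0 x0O] : exists x, x \in Omega by apply/set0Pn.
have V_gt0 : (0 < #|V|)%N by apply/card_gt0P; exists x0.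
have [u [l [u_neq0 ul lmax]]] := rayleigh_max (wform_bilinear (restr Omega m))
  robin_form_bilinear V_gt0 robin_form_gt0.
have x0D : x0 \in clos by rewrite in_closure x0O.
(* The Dirac mass at an interior vertex has a positive numerator. *)
have l_gt0 : 0 < l.
  rewrite ltNge; apply/negP => l_le0.
  have := lmax (dirac R x0); rewrite wform_dirac /restr x0O ffunE eqxx mulr1.
  rewrite leNgt => /negP; apply; apply: le_lt_trans (vm_gt0 x0D).
  by rewrite mulr_le0_ge0 // robin_form_ge0.
have key x : restr Omega m x * u x =
    l * (outflow u x + k * (restr bdry m x * u x) + off x * u x).
  by rewrite -robin_form_dirac -ul wform_dirac.
have l_eig : is_robin_eigenvalue mu Omega k l^-1.
  exists u; split.
  - have [x ux] : exists x, u x != 0.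
      apply: contrapT => u0; move/eqP: u_neq0; apply; apply/ffunP => x.
      by rewrite ffunE; apply: contrapT => /eqP ux; apply: u0; exists x.
    (* Off the closure the equation [key] reads [0 = l * u x]. *)
    exists x => //; apply: contraNT ux => xD.
    have := key x; rewrite /restr -(negbK (x \in Omega)) -(negbK (x \in bdry)).
    have /norP[-> ->] : ~~ ((x \in Omega) || (x \in bdry)) by rewrite -in_closure.
    rewrite /= outflow_off // off_out // !mul0r mulr0 !add0r mul1r.
    by move=> /esym/eqP; rewrite mulf_eq0 gt_eqF.
  - move=> x xO; have xD : x \in clos by rewrite in_closure xO.
    have xB : x \notin bdry by apply: contraTN xO; exact: bdry_notin.
    have := key x; rewrite laplacianE // /restr xO (negbTE xB) off_in //.
    rewrite !mul0r mulr0 !addr0 => /(canLR (mulKf (lt0r_neq0 l_gt0))) <-.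
    have := lt0r_neq0 (vm_gt0 xD); have := lt0r_neq0 l_gt0 => ? ?; field.
    by apply/andP.
  move=> z zB; have zD := bdry_in_closure zB.
  have := key z; rewrite normal_derivE // /restr zB (negbTE (bdry_notin zB)) off_in //.
  rewrite !mul0r addr0 => /esym/eqP; rewrite mulf_eq0 gt_eqF //= => /eqP out0.
  have mz := lt0r_neq0 (vm_gt0 zD).
  have -> : outflow u z = - (k * (m z * u z)) by lra.
  by field.
have l_min l' : is_robin_eigenvalue mu Omega k l' -> l^-1 <= l'.
  move=> [v [[x xD vx] vO vB]].
  have vE := robin_outflowE vO vB.
  (* The values of [v] off the closure are arbitrary. The cutoff keeps its equation, and pairing
     that equation with [g] shows that the quotient at [g] is [1 / l']. *)
  pose g : U := [ffun y => if y \in clos then v y else 0].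
  have gv : {in clos, g =1 v} by move=> y yD; rewrite ffunE yD.
  have g_neq0 : g != 0.
    by apply: contra_neq vx => /ffunP/(_ x); rewrite !ffunE xD.
  have gP : robin_form g g = l' * wform (restr Omega m) g g.
    rewrite /robin_form green /wform !mulr_sumr -!big_split; apply: eq_bigr => y _ /=.
    have [yD|yD] := boolP (y \in clos); last first.
      by rewrite !ffunE (negbTE yD); ring.
    rewrite off_in // mul0r addr0 gv // (outflow_eq gv) // [in RHS]mulrA mulrCA.
    rewrite [v y * v y]mulrC; have := vE y yD => h.
    transitivity (v y * (outflow v y + k * (restr bdry m y * v y))); first ring.
    by rewrite h; ring.
  have Pg := robin_form_gt0 g_neq0.
  have Sg : 0 < wform (restr Omega m) g g.
    rewrite lt_def wform_ge0 ?andbT => [|y]; last exact: restr_vm_ge0.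
    by apply: contraTneq Pg => S0; rewrite gP S0 mulr0 ltxx.
  have := lmax g; rewrite gP mulrA ler_pMl // => h.
  by rewrite -(ler_pM2l l_gt0) divff // gt_eqF.
have -> : robin_eigenvalue1 mu Omega k = l^-1.
  rewrite /robin_eigenvalue1; case: xgetP => [r _ [r_eig r_min]|/(_ l^-1)[]] //.
  by apply/eqP; rewrite eq_le r_min // l_min.
split=> [|g g0]; first by rewrite invr_gt0.
have := lmax [ffun y => g y].
have -> : ([ffun y => g y] : U) = g :> (V -> R) by apply/funext => y; rewrite ffunE.
have -> : robin_form g g = energy g g + k * wform (restr bdry m) g g.
  rewrite /robin_form [wform off _ _]big1 ?addr0 // => x _.
  have [xD|xD] := boolP (x \in clos); first by rewrite off_in ?mul0r.
  by rewrite g0 ?mul0r ?mulr0 // finset.in_setC.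
by move=> h; rewrite mulrC ler_pdivrMr // mulrC.
Qed.
End Robin.

(** * Harmonic extensions *)

Lemma harmonic_unique0 (d : V -> R) : {in Omega, forall x, outflow d x = 0} ->
  (forall x, x \notin Omega -> d x = 0) -> forall x, d x = 0.
Proof.
move=> dO d0 x; have [xO|] := boolP (x \in Omega); last exact: d0.
have [z zB] := bdry_ex; rewrite -(d0 z (bdry_notin zB)).
(* By Green's formula the energy of [d] is zero, since at every vertex either the outflow or [d]
   vanishes; so [d] is constant on the closure and equals its boundary value 0. *)
apply: energy_eq0; last 2 first.
- by rewrite in_closure xO.
- exact: bdry_in_closure.
rewrite green big1 // => y _; have [/dO ->|/d0 ->] := boolP (y \in Omega).
  by rewrite mulr0.
by rewrite mul0r.
Qed.

Lemma outflowD (a : R) (u v : V -> R) x :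
  outflow (fun y => a * u y + v y) x = a * outflow u x + outflow v x.
Proof.
by rewrite /outflow mulr_sumr -big_split; apply: eq_bigr => y _ /=; ring.
Qed.

Lemma laplacian_eq0 (u : V -> R) x : x \in Omega ->
  (laplacian mu Omega u x = 0) <-> (outflow u x = 0).
Proof.
move=> xO; have mx : m x != 0 by rewrite gt_eqF // vm_gt0 // in_closure xO.
rewrite laplacianE //; split=> [/eqP|->]; last by rewrite mulr0 oppr0.
by rewrite oppr_eq0 mulf_eq0 invr_eq0 (negbTE mx) => /eqP.
Qed.

Local Notation B := (bfun mu Omega).

Lemma harmonic_ext_unique (phi : B) (u v : V -> R) :
  is_harmonic_ext phi u -> is_harmonic_ext phi v -> u =1 v.
Proof.
move=> [uO uB uo] [vO vB vo] x; apply/eqP; rewrite -subr_eq0; apply/eqP.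
rewrite -[u x]mul1r -[- v x]mul1r; move: x.
suff h x : -1 * v x + u x = 0 by move=> x; have := h x; lra.
apply: (@harmonic_unique0 (fun y => -1 * v y + u y)) => [y yO|y yO].
  rewrite outflowD; have /(laplacian_eq0 _ yO) -> := uO y yO.
  by have /(laplacian_eq0 _ yO) -> := vO y yO; rewrite mulr0 addr0.
have [yB|yB] := boolP (y \in bdry).
  by have := uB (Sub y yB); have := vB (Sub y yB); rewrite SubK => -> ->; ring.
have yD : y \notin clos by rewrite in_closure negb_or yO.
by rewrite uo // vo //; ring.
Qed.

(** Existence follows from uniqueness: the endomorphism [T], which takes the outflow in [Omega] and
    the value elsewhere, is injective, hence onto in finite dimension. *)
Lemma harmonic_ext_exists (phi : B) : exists u : U, is_harmonic_ext phi u.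
Proof.
pose T (u : U) : U := [ffun x => if x \in Omega then outflow u x else u x].
have T_lin : linear T.
  move=> a u v; apply/ffunP => x; rewrite !ffunE; case: ifP => // _.
  rewrite -[RHS]outflowD; apply: eq_bigr => y _; rewrite !ffunE; done.
pose L : {linear U -> U} := HB.pack T (GRing.isLinear.Build _ _ _ _ T T_lin).
have ker0 : lker (linfun L) == 0%VS.
  apply/lker0P => u v; rewrite !lfunE /= => Tuv; apply/eqP; rewrite -subr_eq0.
  apply/eqP/ffunP => x; rewrite [RHS]ffunE.
  have T0 y : T (u - v) y = 0.
    by rewrite -[u - v]addrC -scaleN1r T_lin Tuv !ffunE scaleN1r addNr.
  apply: harmonic_unique0 x => [y yO|y /negbTE yO]; have := T0 y.
    by rewrite ffunE yO.
  by rewrite ffunE yO.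
have [u uE] : exists u, T u = [ffun x => if insub x is Some z then phi z else 0].
  have := lker0_limgf ker0 => /vspaceP.
  set b := finfun _; move=> /(_ b); rewrite memvf => /memv_imgP[u _ ->].
  by exists u; rewrite lfunE.
have uE' x := congr1 (fun u : U => u x) uE; exists u; split.
- move=> x xO; apply/laplacian_eq0 => //; have := uE' x; rewrite !ffunE xO => ->.
  by rewrite insubF //; apply/negP => /bdry_notin; rewrite xO.
- move=> z; have := uE' (val z); rewrite !ffunE (negbTE (bdry_notin (valP z))) => ->.
  by rewrite valK.
move=> x; rewrite in_closure negb_or => /andP[xO xB]; have := uE' x.
by rewrite !ffunE (negbTE xO) insubN.
Qed.

Lemma harmonic_extP (phi : B) : is_harmonic_ext phi (harmonic_ext phi).
Proof.
rewrite /harmonic_ext; case: xgetP => [u _ //|none].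
by have [u /none] := harmonic_ext_exists phi.
Qed.

Lemma harmonic_ext_eq (phi : B) (u : U) : is_harmonic_ext phi u ->
  harmonic_ext phi = u.
Proof.
by move=> uP; apply/ffunP/(harmonic_ext_unique (harmonic_extP phi) uP).
Qed.

Lemma harmonic_ext_linear (a : R) (phi psi : B) :
  harmonic_ext (a *: phi + psi) =
  (a *: (harmonic_ext phi : U) + harmonic_ext psi : U).
Proof.
have [uO uB uo] := harmonic_extP phi; have [vO vB vo] := harmonic_extP psi.
apply: harmonic_ext_eq; split=> [x xO|z|x xD].
- apply/laplacian_eq0 => //; transitivity
    (outflow (fun y => a * harmonic_ext phi y + harmonic_ext psi y) x).
    by apply: eq_bigr => y _; rewrite !ffunE.
  rewrite outflowD; have /(laplacian_eq0 _ xO) -> := uO x xO.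
  by have /(laplacian_eq0 _ xO) -> := vO x xO; rewrite mulr0 addr0.
- by rewrite !ffunE uB vB.
by rewrite !ffunE uo // vo // scaler0 addr0.
Qed.

(** * The Dirichlet-to-Neumann operator and the Steklov problem *)

Lemma DtNE (phi : B) z :
  DtN phi z = (m (val z))^-1 * outflow (harmonic_ext phi) (val z).
Proof. by rewrite ffunE normal_derivE // (valP z). Qed.

Lemma DtN_linear : linear (@DtN R V mu Omega).
Proof.
move=> a phi psi; apply/ffunP => z; rewrite !ffunE -/(DtN _ _) !normal_derivE ?(valP z) //.
rewrite harmonic_ext_linear.
transitivity ((m (val z))^-1 * outflow
   (fun y => a * harmonic_ext phi y + harmonic_ext psi y) (val z)).
  by congr (_ * _); apply: eq_bigr => y _; rewrite !ffunE.
by rewrite outflowD /GRing.scale /=; ring.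
Qed.

(** [linfun] is known to agree with its argument for linear maps only, hence the packing of [DtN]
    with its linearity. *)
Lemma DtN_opE (phi : B) : DtN_op mu Omega phi = DtN phi.
Proof.
pose L : {linear B -> B} :=
  HB.pack (@DtN R V mu Omega) (GRing.isLinear.Build _ _ _ _ _ DtN_linear).
by rewrite /DtN_op (lfunE L).
Qed.

(** Weak form of the Steklov problem: [u] is harmonic in [Omega] with normal derivative [l * u] on
    the boundary. The second clause matches the normalization of [harmonic_ext]. *)
Definition is_steklov (l : R) (u : V -> R) : Prop :=
  (forall v : V -> R, energy u v = l * wform (restr bdry m) u v) /\
  forall x, x \notin clos -> u x = 0.

Lemma steklov_of_eigen (phi : B) l : phi \in passmx.leigenspace (DtN_op mu Omega) l ->
  is_steklov l (harmonic_ext phi).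
Proof.
rewrite mem_leigenspace DtN_opE => /eqP phi_eig.
have [uO uB uo] := harmonic_extP phi; split=> // v.
rewrite green /wform mulr_sumr; apply: eq_bigr => x _; rewrite /restr.
case: ifP => [xB|xB].
  have := congr1 (fun f : B => f (Sub x xB)) phi_eig; rewrite DtNE ffunE -uB SubK.
  have mx : m x != 0 by rewrite gt_eqF // vm_gt0 // bdry_in_closure.
  move=> /(congr1 ( *%R (m x))); rewrite mulVKf // => ->.
  by rewrite /GRing.scale /=; ring.
rewrite mul0r mulr0; have [xO|xO] := boolP (x \in Omega).
  by have /(laplacian_eq0 _ xO) -> := uO x xO; rewrite mulr0.
by rewrite outflow_off ?mulr0 // in_closure negb_or xO xB.
Qed.

Lemma eigen_of_steklov (u : U) l : is_steklov l u -> u != 0 ->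
  exists2 phi : B, phi != 0 & phi \in passmx.leigenspace (DtN_op mu Omega) l.
Proof.
move=> [uE uo] u_neq0; pose phi : B := [ffun z => u (val z)].
have uD x := uE (dirac R x).
have uO : {in Omega, forall x, outflow u x = 0}.
  move=> x xO; have := uD x; rewrite energy_dirac wform_dirac /restr.
  rewrite ifF ?mul0r ?mulr0 //; by apply/negP => /bdry_notin; rewrite xO.
have uH : harmonic_ext phi = u.
  apply: harmonic_ext_eq; split=> // [x xO|z]; last by rewrite ffunE.
  by apply/laplacian_eq0 => //; exact: uO.
exists phi.
  apply: contra_neq u_neq0 => phi0; apply/ffunP => x; rewrite ffunE.
  apply: harmonic_unique0 x => // x xO.
  have [xB|xB] := boolP (x \in bdry); last by rewrite uo // in_closure negb_or xO.
  by have := congr1 (fun f : B => f (Sub x xB)) phi0; rewrite !ffunE SubK.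
rewrite mem_leigenspace DtN_opE; apply/eqP/ffunP => z; rewrite DtNE uH !ffunE.
have zB := valP z; have mz : m (val z) != 0 by rewrite gt_eqF // vm_gt0 // bdry_in_closure.
have := uD (val z); rewrite energy_dirac wform_dirac /restr zB => ->.
by rewrite mulrCA mulKf.
Qed.

Lemma nonneg_sum3_eq0 (a b c : R) : 0 <= a -> 0 <= b -> 0 <= c ->
  a + b + c = 0 -> [/\ a = 0, b = 0 & c = 0].
Proof. by move=> *; split; lra. Qed.

(** The numerator [S] is the covariance for the boundary measure, which vanishes on constants; the
    squared [mass] in [P] restores the definiteness that the energy loses on constants. *)
Lemma steklov_neq0_exists : exists2 l : R, l != 0 &
  exists2 u : U, is_steklov l u & u != 0.
Proof.
pose c := restr bdry m; pose mass u := wform c (fun=> 1) u.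
have c0 x : 0 <= c x by exact: restr_vm_ge0.
have mass_lin a (u v : U) : mass (a *: u + v) = a * mass u + mass v.
  rewrite /mass /wform mulr_sumr -big_split; apply: eq_bigr => x _.
  by rewrite /= !ffunE /GRing.scale /=; ring.
pose M := mass (fun=> 1).
have ME : M = \sum_x c x by apply: eq_bigr => x _; rewrite !mulr1.
have [z zB] := bdry_ex; have cz : c z = m z by rewrite /c /restr zB.
have [z' z'B z'z] : exists2 z', z' \in bdry & z' != z.
  apply: contrapT => none; move: bdry_ge2; rewrite ltnNge -(cards1 z) => /negP; apply.
  apply/subset_leq_card/fintype.subsetP => y yB; rewrite inE.
  by apply: contrapT => /negP yz; apply: none; exists y.
have mz_gt0 : 0 < m z by rewrite vm_gt0 // bdry_in_closure.
have M_gt : m z < M.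
  rewrite ME (bigD1 z) //= cz ltrDl (bigD1 z') //= ltr_pwDl ?sumr_ge0 //.
  by rewrite /c /restr z'B vm_gt0 // bdry_in_closure.
have M_gt0 : 0 < M := lt_trans mz_gt0 M_gt.
have mass_const (u : V -> R) : (forall x, x \in bdry -> u x = u z) -> mass u = u z * M.
  move=> uz; rewrite ME mulr_sumr; apply: eq_bigr => x _; rewrite /c /restr.
  by case: ifP => [/uz ->|_]; ring.
pose S (u v : U) := wform c u v - mass u * mass v / M.
pose P (u v : U) := energy u v + mass u * mass v + wform off u v.
have S_bil : sym_bilinear S.
  have [sb lb] := wform_bilinear c.
  split=> [u v|v a u u']; first by rewrite /S sb; ring.
  by rewrite /S lb mass_lin; field; rewrite gt_eqF.
have P_bil : sym_bilinear P.
  have [sb lb] := wform_bilinear off; have [se le] := energy_bilinear.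
  split=> [u v|v a u u']; first by rewrite /P sb se; ring.
  by rewrite /P lb le mass_lin; ring.
have P_ge0 u : 0 <= P u u.
  apply: addr_ge0 (wform_ge0 _ off_ge0); apply: addr_ge0 (energy_ge0 u) _.
  by rewrite -expr2 sqr_ge0.
have P_gt0 (u : U) : u != 0 -> 0 < P u u.
  rewrite lt_def P_ge0 andbT; apply: contra_neq.
  have mass_ge0 : 0 <= mass u * mass u by rewrite -expr2 sqr_ge0.
  move=> /(nonneg_sum3_eq0 (energy_ge0 u) mass_ge0 (wform_ge0 u off_ge0)).
  move=> [e0 /eqP mass0 o0]; apply: (posdef_of_bdry zB) => //.
  move: mass0; rewrite -expr2 sqrf_eq0 mass_const => [|x xB]; last first.
    by apply: (energy_eq0 e0); exact: bdry_in_closure.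
  by rewrite mulf_eq0 (gt_eqF M_gt0) orbF => /eqP.
have V_gt0 : (0 < #|V|)%N by apply/card_gt0P; exists z.
have [u [t [u_neq0 uE tmax]]] := rayleigh_max S_bil P_bil V_gt0 P_gt0.
have mass_dirac x : mass (dirac R x) = c x.
  by rewrite /mass wform_dirac mulr1.
(* At [dirac z] the form [S] equals [m z - m z ^+ 2 / M], positive because a second boundary vertex
   makes [m z < M]. *)
have t_gt0 : 0 < t.
  rewrite ltNge; apply/negP => t_le0; have := tmax (dirac R z).
  have : t * P (dirac R z) (dirac R z) <= 0 by rewrite mulr_le0_ge0.
  have : 0 < S (dirac R z) (dirac R z).
    rewrite /S wform_dirac ffunE eqxx mulr1 mass_dirac cz subr_gt0.
    by rewrite ltr_pdivrMr // ltr_pM2l.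
  lra.
have u_off x : x \notin clos -> u x = 0.
  move=> xD; have := uE (dirac R x); rewrite /S /P !wform_dirac energy_dirac.
  have cx : c x = 0.
    by rewrite /c /restr; case: ifP => // /bdry_in_closure; rewrite (negbTE xD).
  rewrite mass_dirac cx outflow_off // off_out // mul1r mulr0 !mul0r subrr !add0r.
  by move=> /esym/eqP; rewrite mulf_eq0 gt_eqF //= => /eqP.
have off0 (v : V -> R) : wform off u v = 0.
  rewrite /wform big1 // => x _; have [xD|xD] := boolP (x \in clos).
    by rewrite off_in // mul0r.
  by rewrite u_off // mul0r mulr0.
pose one : U := [ffun=> 1].
have oneE : one = (fun=> 1) :> (V -> R) by apply/funext => x; rewrite ffunE.
(* Against the constant 1 both [S] and the energy vanish, which leaves [t * (mass u * M) = 0]; the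
   correction terms of [S] and [P] then disappear. *)
have mass0 : mass u = 0.
  have := uE one; rewrite /S /P oneE off0 -/M.
  have -> : wform c u (fun=> 1) = mass u.
    by apply: eq_bigr => x _; rewrite mulr1 mul1r.
  have -> : energy u (fun=> 1) = 0.
    by rewrite energy_sym green big1 // => x _;
      rewrite /outflow big1 ?mulr0 // => y _; rewrite subrr mulr0.
  rewrite mulfK ?gt_eqF // subrr add0r addr0 => /esym/eqP.
  rewrite !mulf_eq0 (gt_eqF t_gt0) (gt_eqF M_gt0) /=.
  by rewrite orbF => /eqP.
exists t^-1; first by rewrite invr_eq0 gt_eqF.
exists u => //; split=> // v; have := uE [ffun x => v x]; rewrite /S /P.
have -> : ([ffun x => v x] : U) = v :> (V -> R) by apply/funext => x; rewrite ffunE.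
by rewrite off0 mass0 !mul0r subr0 !addr0 => ->; rewrite mulKf // gt_eqF.
Qed.

Lemma steklov_bdry_gt0 (u : U) l : is_steklov l u -> u != 0 ->
  0 < wform (restr bdry m) u u.
Proof.
move=> [uE uo]; rewrite lt_def wform_ge0 ?andbT => [|x]; last exact: restr_vm_ge0.
apply: contra_neq => w0; have [z zB] := bdry_ex; apply: (posdef_of_bdry zB).
- apply: (wform_eq0 (restr_vm_ge0 bdry) w0).
  by rewrite /restr zB vm_gt0 // bdry_in_closure.
- by rewrite uE w0 mulr0.
rewrite /wform big1 // => x _; have [xD|xD] := boolP (x \in clos).
  by rewrite off_in // mul0r.
by rewrite uo // !mulr0.
Qed.

Lemma steklov_ge0 (u : U) l : is_steklov l u -> u != 0 -> 0 <= l.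
Proof.
move=> us u0; have := energy_ge0 u; rewrite us.1 pmulr_lge0 //.
exact: steklov_bdry_gt0 us u0.
Qed.

Lemma eigenvalue_steklov l : (0 < \dim (passmx.leigenspace (DtN_op mu Omega) l))%N ->
  exists2 u : U, is_steklov l u & u != 0.
Proof.
rewrite lt0n dimv_eq0 -vpick0 => phi0.
have phiP := memv_pick (passmx.leigenspace (DtN_op mu Omega) l).
exists (harmonic_ext (vpick (passmx.leigenspace (DtN_op mu Omega) l))).
  exact: steklov_of_eigen.
apply: contra_neq phi0 => h0; apply/ffunP => z.
have [_ <- _] := harmonic_extP (vpick (passmx.leigenspace (DtN_op mu Omega) l)).
by rewrite h0 !ffunE.
Qed.

Lemma steklov_eigenvalue (u : U) l : is_steklov l u -> u != 0 ->
  (0 < \dim (passmx.leigenspace (DtN_op mu Omega) l))%N.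
Proof.
move=> us /(eigen_of_steklov us)[phi phi0 phiP]; rewrite lt0n dimv_eq0.
by apply: contraNneq phi0 => E0; rewrite E0 memv0 in phiP.
Qed.

Lemma dim_eigenspace0 : (\dim (passmx.leigenspace (DtN_op mu Omega) 0) <= 1)%N.
Proof.
pose one : B := [ffun=> 1].
have sub : (passmx.leigenspace (DtN_op mu Omega) 0 <= <[one]>)%VS.
  apply/subvP => phi /steklov_of_eigen [uE _].
  have [z zB] := bdry_ex; apply/vlineP; exists (harmonic_ext phi z).
  apply/ffunP => x; have [_ <- _] := harmonic_extP phi.
  have e0 : energy (harmonic_ext phi) (harmonic_ext phi) = 0 by rewrite uE mul0r.
  rewrite (energy_eq0 e0 (bdry_in_closure (valP x)) (bdry_in_closure zB)).
  by rewrite !ffunE /GRing.scale /= mulr1.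
by apply: leq_trans (dimvS sub) _; rewrite dim_vline; case: (_ != 0).
Qed.

Lemma dim_eigenspace0_gt0 : (0 < \dim (passmx.leigenspace (DtN_op mu Omega) 0))%N.
Proof.
pose u : U := [ffun x => (x \in clos)%:R].
apply: (@steklov_eigenvalue u); last first.
  have [z zB] := bdry_ex; apply/eqP => /ffunP/(_ z)/eqP.
  by rewrite !ffunE bdry_in_closure // oner_eq0.
split=> [v|x xD]; last by rewrite ffunE (negbTE xD).
rewrite green mul0r big1 // => x _; have [xD|xD] := boolP (x \in clos).
  have uc : {in clos, u =1 (fun=> 1)} by move=> y yD; rewrite ffunE yD.
  rewrite (outflow_eq uc) // /outflow big1 ?mulr0 // => y _.
  by rewrite subrr mulr0.
by rewrite outflow_off ?mulr0.
Qed.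

(** The list contains 0 and another value, so index 1 is a true entry and not the default of [nth].
    All entries are nonnegative and sorted, so a zero second entry would force a zero first one,
    although the eigenspace of 0 is a line. *)
Lemma DtN_eigenvalue1P : DtN_eigenvalue mu Omega 1 != 0 /\
  exists2 u : U, is_steklov (DtN_eigenvalue mu Omega 1) u & u != 0.
Proof.
rewrite /DtN_eigenvalue; have [] := spectrumP (DtN_op mu Omega).
move: (spectrum _) => s s_sorted sP.
have mem_s r : (r \in s) = (0 < \dim (passmx.leigenspace (DtN_op mu Omega) r))%N.
  by rewrite -has_pred1 has_count sP.
have s0 : 0 \in s by rewrite mem_s dim_eigenspace0_gt0.
have [l l_neq0 [u us u0]] := steklov_neq0_exists.
have sl : l \in s by rewrite mem_s (steklov_eigenvalue us u0).
have count0 : (count_mem 0%R s <= 1)%N by rewrite sP dim_eigenspace0.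
case: s s_sorted sP mem_s s0 sl count0 => [//|x [|y s]] /= s_sorted _ mem_s.
  by rewrite !inE => /eqP <-; rewrite (negbTE l_neq0).
have ge0 r : r \in [:: x, y & s] -> 0 <= r.
  by rewrite mem_s => /eigenvalue_steklov[v vs v0]; exact: steklov_ge0 vs v0.
move=> _ _ count0; split; last first.
  by apply: eigenvalue_steklov; rewrite -mem_s !inE eqxx orbT.
apply: contraTneq count0 => y0; move: s_sorted => /andP[xy _].
have -> : x = 0.
  by apply/eqP; rewrite eq_le ge0 ?inE ?eqxx // -{1}y0 xy.
by rewrite y0 eqxx.
Qed.

(** * Cuts, total variation and the coarea inequality *)

Lemma edge_weightE x y : edge_weight mu [set x; y]%SET = mu x y.
Proof.
rewrite /edge_weight; case: pickP => [[p q] /eqP/= pq|/(_ (x, y))]; last first.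
  by rewrite eqxx.
have : x \in [set p; q]%SET by rewrite -pq !inE eqxx.
have : y \in [set p; q]%SET by rewrite -pq !inE eqxx orbT.
have : p \in [set x; y]%SET by rewrite pq !inE eqxx.
have : q \in [set x; y]%SET by rewrite pq !inE eqxx orbT.
by rewrite !inE => /orP[]/eqP -> /orP[]/eqP -> /orP[]/eqP ? /orP[]/eqP ?; subst.
Qed.

Definition total_variation (F : V -> R) : R :=
  2^-1 * \sum_x \sum_y w x y * `|F x - F y|.

(** A cut edge has exactly one end in [A]; listing that end first matches cut edges with ordered
    pairs of positive weight. *)
Lemma weight_tbdry (A : {set V}) :
  weight mu (tbdry mu Omega A) = \sum_(x in A) \sum_(y in ~: A) w x y.
Proof.
pose P : {set V * V} := [set p : V * V | [&& p.1 \in A, p.2 \notin A & 0 < w p.1 p.2]]%SET.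
have -> : tbdry mu Omega A = [set [set p.1; p.2]%SET | p in P]%SET.
  apply/setP => e; rewrite /tbdry finset.in_setI; apply/andP/imsetP.
    case=> /imsetP[[x y]]; rewrite inE /= finset.in_setC => /and3P[xA yA _] ->.
    by rewrite -/(tadj mu Omega x y) tweightE => wxy; exists (x, y) => //; rewrite inE xA yA.
  case=> -[x y]; rewrite inE /= => /and3P[xA yA wxy] ->; split; last first.
    by rewrite -/(tadj mu Omega x y) tweightE.
  apply/imsetP; exists (x, y) => //; rewrite inE /= finset.in_setC xA yA /=.
  by move: wxy; rewrite /w /adj; case: ifP; rewrite ?ltxx.
rewrite /weight big_imset /=; last first.
  move=> [x y] [x' y']; rewrite !inE /= => /and3P[xA yA _] /and3P[x'A y'A _] /setP e.
  have := e x; have := e y; rewrite !inE !eqxx orbT /=.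
  move=> /esym/orP[]/eqP yE /esym/orP[]/eqP xE; subst => //.
  - by rewrite x'A in yA.
  - by rewrite x'A in yA.
  - by rewrite xA in y'A.
rewrite pair_big /= [RHS]big_mkcond [LHS]big_mkcond.
apply: eq_bigr => -[x y] _; rewrite inE /= edge_weightE finset.in_setC.
case: (x \in A) => //=; case: (y \in A) => //=; case: ifPn => [|].
  by rewrite /w; case: ifP; rewrite ?ltxx.
by rewrite -leNgt => w0; apply/eqP; rewrite eq_le w0 tweight_ge0.
Qed.

Lemma total_variation_indicator (A : {set V}) :
  total_variation (fun x => (x \in A)%:R) = weight mu (tbdry mu Omega A).
Proof.
rewrite weight_tbdry.
have E : \sum_(x in A) \sum_(y in ~: A) w x y =
    \sum_x \sum_y w x y * ((x \in A) && (y \notin A))%:R.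
  rewrite big_mkcond; apply: eq_bigr => x _; case: (x \in A); last first.
    by rewrite big1 // => y _; rewrite mulr0.
  rewrite big_mkcond; apply: eq_bigr => y _; rewrite finset.in_setC.
  by case: (y \in A); rewrite ?mulr0 ?mulr1.
have E' : \sum_(x in A) \sum_(y in ~: A) w x y =
    \sum_x \sum_y w x y * ((y \in A) && (x \notin A))%:R.
  rewrite E exchange_big; apply: eq_bigr => x _; apply: eq_bigr => y _.
  by rewrite tweight_sym.
rewrite /total_variation.
have -> : \sum_x \sum_y w x y * `|(x \in A)%:R - (y \in A)%:R| =
    2 * \sum_(x in A) \sum_(y in ~: A) w x y; last by field.
rewrite mulr_natl mulr2n {1}E E' -big_split; apply: eq_bigr => x _.
rewrite -big_split; apply: eq_bigr => y _ /=.
by case: (x \in A); case: (y \in A);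
  rewrite /= ?(subrr, subr0, sub0r, normrN, normr0, normr1); ring.
Qed.

Lemma total_variation_ge0 F : 0 <= total_variation F.
Proof.
rewrite mulr_ge0 ?invr_ge0 ?ler0n // sumr_ge0 // => x _; rewrite sumr_ge0 // => y _.
by rewrite mulr_ge0 ?tweight_ge0.
Qed.

Local Notation h := (escobar_cheeger mu Omega).

Lemma meas_ge0 (A : {set V}) : 0 <= meas mu Omega A.
Proof. by rewrite sumr_ge0 // => x _; exact: vm_ge0. Qed.

(** Clearing the denominator covers sets of zero boundary measure, which the infimum leaves out but
    which may occur as supports in the coarea induction. *)
Lemma escobar_cheeger_le (A : {set V}) : A \subset clos ->
  meas mu Omega (A :&: bdry) <= 2^-1 * meas mu Omega bdry ->
  h * meas mu Omega (A :&: bdry) <= total_variation (fun x => (x \in A)%:R).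
Proof.
move=> AD Ahalf; have [A_gt0|] := ltP 0 (meas mu Omega (A :&: bdry)); last first.
  move=> le0; have -> : meas mu Omega (A :&: bdry) = 0.
    by apply/eqP; rewrite eq_le le0 meas_ge0.
  by rewrite mulr0 total_variation_ge0.
rewrite total_variation_indicator -ler_pdivlMr //; apply: ge_inf; last by exists A.
exists 0 => _ [C [_ C_gt0 _ ->]]; rewrite divr_ge0 ?(ltW C_gt0) //.
by rewrite -total_variation_indicator total_variation_ge0.
Qed.

(* Induction on the size of the support: subtracting from F its least positive
   value on the support A splits off a multiple of the indicator of A. *)
Lemma escobar_coarea (F : V -> R) : (forall x, 0 <= F x) ->
  (forall x, x \notin clos -> F x = 0) ->
  meas mu Omega ([set x | 0 < F x]%SET :&: bdry) <= 2^-1 * meas mu Omega bdry ->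
  h * \sum_(x in bdry) m x * F x <= total_variation F.
Proof.
have [n] := ubnP #|[set x | 0 < F x]%SET|; elim: n F => // n IH F.
set A := [set x | 0 < F x]%SET => An F0 Foff Ahalf.
have AE x : (x \in A) = (0 < F x) by rewrite inE.
have notA x : x \notin A -> F x = 0.
  by rewrite AE -leNgt => le0; apply/eqP; rewrite eq_le le0 F0.
have [A0|[a aA]] := set_0Vmem A.
  rewrite big1 ?mulr0 ?total_variation_ge0 // => x _.
  by rewrite notA ?mulr0 // A0 inE.
have [x0 x0P x0min] := @arg_minP _ R V a (mem A) F aA.
have x0A : x0 \in A by exact: x0P.
pose t := F x0; have t_gt0 : 0 < t by rewrite /t -AE.
pose G x := F x - t * (x \in A)%:R.
have G0 x : 0 <= G x.
  rewrite /G; have [xA|xA] := boolP (x \in A); last by rewrite mulr0 subr0.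
  by rewrite mulr1 subr_ge0 x0min.
have supp : [set x | 0 < G x]%SET \subset A :\ x0.
  apply/fintype.subsetP => x; rewrite !inE /G.
  have [xA|/notA ->] := boolP (x \in A); last by rewrite mulr0 subrr ltxx.
  rewrite mulr1 -AE xA andbT; apply: contraTneq => ->.
  by rewrite subrr ltxx.
have sub_meas : meas mu Omega ([set x | 0 < G x]%SET :&: bdry) <=
    meas mu Omega (A :&: bdry).
  rewrite /meas big_mkcond [leRHS]big_mkcond ler_sum // => x _.
  rewrite !finset.in_setI; case: (boolP (x \in bdry)); rewrite ?andbF // !andbT => _.
  case: ifPn => [/(fintype.subsetP supp)|_]; first by rewrite finset.in_setD1 => /andP[_ ->].
  by case: ifP => // _; exact: vm_ge0.
have IHG : h * \sum_(x in bdry) m x * G x <= total_variation G.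
  apply: IH => //; last exact: le_trans sub_meas Ahalf.
    rewrite -ltnS; apply: leq_trans An; rewrite ltnS (leq_ltn_trans (subset_leq_card supp)) //.
    by rewrite [X in (_ < X)%N](cardsD1 x0) x0A.
  move=> x xD; rewrite /G Foff // AE Foff // ltxx mulr0 subr0 //.
have AD : A \subset clos.
  apply/fintype.subsetP => x; rewrite AE; apply: contraTT => /Foff ->.
  by rewrite ltxx.
have cheeger := escobar_cheeger_le AD Ahalf.
have -> : \sum_(x in bdry) m x * F x =
    \sum_(x in bdry) m x * G x + t * meas mu Omega (A :&: bdry).
  have -> : meas mu Omega (A :&: bdry) = \sum_(x in bdry) m x * (x \in A)%:R.
    rewrite /meas big_mkcond [RHS]big_mkcond; apply: eq_bigr => x _.
    rewrite finset.in_setI; case: (x \in A) => /=; case: (x \in bdry) => //;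
      by rewrite ?mulr1 ?mulr0.
  by rewrite mulr_sumr -big_split; apply: eq_bigr => x _; rewrite /G /=; ring.
(* Variations add without cancellation: [G] is nonnegative and vanishes off [A], so its increments
   never have the sign opposite to those of the indicator. *)
have -> : total_variation F =
    total_variation G + t * total_variation (fun x => (x \in A)%:R).
  rewrite /total_variation mulrCA -mulrDr; congr (_ * _); rewrite mulr_sumr -big_split.
  apply: eq_bigr => x _; rewrite mulr_sumr -big_split; apply: eq_bigr => y _ /=.
  rewrite mulrCA -mulrDr; congr (_ * _); rewrite -[in t * _](gtr0_norm t_gt0) -normrM.
  have Gx := G0 x; have Gy := G0 y; rewrite /G in Gx Gy *.
  have [xA|/notA Fx] := boolP (x \in A); have [yA|/notA Fy] := boolP (y \in A);
    rewrite ?xA ?yA ?Fx ?Fy /= in Gx Gy *.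
  - by rewrite subrr mulr0 normr0 addr0; congr (Num.norm _); ring.
  - rewrite !ger0_norm; lra.
  - rewrite !ler0_norm; lra.
  - by rewrite !(mulr0, subr0, normr0, addr0).
have := ler_wpM2l (ltW t_gt0) cheeger; rewrite mulrDr mulrCA => ?; lra.
Qed.

(** * The eigenvalue estimate *)

Lemma steklov_cheeger (k a l : R) (u : U) : 0 < k -> Omega != finset.set0 -> 0 < a ->
  is_steklov l u ->
  0 < \sum_(x in bdry) m x * Num.max 0 (u x) ^+ 2 ->
  meas mu Omega ([set x | 0 < u x]%SET :&: bdry) <= 2^-1 * meas mu Omega bdry ->
  (2 * h * robin_eigenvalue1 mu Omega k - a * (k + robin_eigenvalue1 mu Omega k)) * a /
    (a ^+ 2 + 2 * robin_eigenvalue1 mu Omega k) <= l.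
Proof.
move=> k_gt0 Omega_neq0 a_gt0 [uE uo] b_gt0 half.
pose mu1 := robin_eigenvalue1 mu Omega k.
have [mu1_gt0 mu1_min] := robin_eigenvalue1P k_gt0 Omega_neq0.
rewrite -/mu1 in mu1_gt0 mu1_min *.
pose g x := Num.max 0 (u x).
have g_gt0 x : (0 < g x ^+ 2) = (0 < u x).
  rewrite lt_def sqr_ge0 andbT sqrf_eq0 /g; case: ltP => [u0|]; last by rewrite eqxx.
  by rewrite gt_eqF.
have go x : x \notin clos -> g x = 0 by move=> xD; rewrite /g uo // maxxx.
set b := \sum_(x in bdry) _ in b_gt0.
have bE : wform (restr bdry m) g g = b.
  rewrite /b [RHS]big_mkcond; apply: eq_bigr => x _; rewrite /restr.
  by case: ifP => _; rewrite ?mul0r // expr2.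
have ugE : wform (restr bdry m) u g = b.
  rewrite -bE; apply: eq_bigr => x _; congr (_ * _); rewrite /g.
  by case: ltP => // _; rewrite !mulr0.
(* Testing [u] against [g] gives [l * b], and termwise [(g x - g y) ^+ 2 <= (u x - u y) * (g x - g
   y)] for positive parts. *)
have eg : energy g g <= l * b.
  rewrite -ugE -uE /energy ler_pM2l ?invr_gt0 ?ltr0n // ler_sum // => x _.
  rewrite ler_sum // => y _; rewrite ler_wpM2l ?tweight_ge0 // /g.
  case: (ltP 0 (u x)) => ux; case: (ltP 0 (u y)) => uy; nra.
have coarea : h * b <= total_variation (fun x => g x ^+ 2).
  apply: (@escobar_coarea (fun x => g x ^+ 2)) => [x|x xD|]; first exact: sqr_ge0.
    by rewrite (go x xD) expr0n.
  by under eq_finset do rewrite g_gt0.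
pose M := wform (restr Omega m) g g.
have sumM : \sum_x m x * g x ^+ 2 = M + b.
  rewrite -bE /M /wform -big_split; apply: eq_bigr => x _ /=; rewrite /restr expr2.
  have [xB|xB] := boolP (x \in bdry); first by rewrite (negbTE (bdry_notin xB)); ring.
  have [xO|xO] := boolP (x \in Omega); first by ring.
  by rewrite go ?in_closure ?negb_or ?xO //; ring.
have robin : mu1 * M <= energy g g + k * b.
  by rewrite -bE mu1_min // => x; rewrite finset.in_setC; exact: go.
have tv : total_variation (fun x => g x ^+ 2) <= a^-1 * energy g g + a / 2 * (M + b).
  have sym : \sum_x \sum_y w x y * (g x ^+ 2 + g y ^+ 2) = 2 * (M + b).
    have one : \sum_x \sum_y w x y * g x ^+ 2 = M + b.
      by rewrite -sumM; apply: eq_bigr => x _; rewrite vmE mulr_suml.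
    have two : \sum_x \sum_y w x y * g y ^+ 2 = M + b.
      rewrite -one exchange_big; apply: eq_bigr => x _; apply: eq_bigr => y _.
      by rewrite tweight_sym.
    rewrite mulr_natl mulr2n -{1}one -two -big_split; apply: eq_bigr => x _.
    by rewrite -big_split; apply: eq_bigr => y _; rewrite /= mulrDr.
  have -> : a^-1 * energy g g + a / 2 * (M + b) = 2^-1 * \sum_x \sum_y w x y *
     (a^-1 * (g x - g y) ^+ 2 + a / 2 * (g x ^+ 2 + g y ^+ 2)).
    have -> : a / 2 * (M + b) = 2^-1 * (a / 2 * (2 * (M + b))) by field.
    rewrite -sym /energy mulrCA -mulrDr; congr (_ * _); rewrite !mulr_sumr -big_split.
    apply: eq_bigr => x _; rewrite /= !mulr_sumr -big_split; apply: eq_bigr => y _ /=.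
    by ring.
  rewrite ler_pM2l ?invr_gt0 ?ltr0n // ler_sum // => x _; rewrite ler_sum // => y _.
  rewrite ler_wpM2l ?tweight_ge0 // subr_sqr normrM.
  (* AM-GM, and (g x + g y)^2 <= 2 (g x^2 + g y^2) *)
  set p := g x; set q := g y; rewrite -(@real_normK _ (p - q)) ?num_real //.
  set d := `|p - q|; set s := `|p + q|.
  have s2 : s ^+ 2 <= 2 * (p ^+ 2 + q ^+ 2).
    rewrite /s real_normK ?num_real //; have := sqr_ge0 (p - q); nra.
  have : 0 <= a^-1 * (d - a / 2 * s) ^+ 2 by rewrite mulr_ge0 ?invr_ge0 ?(ltW a_gt0) ?sqr_ge0.
  have -> : a^-1 * (d - a / 2 * s) ^+ 2 = a^-1 * d ^+ 2 - d * s + a / 4 * s ^+ 2.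
    by field; rewrite gt_eqF.
  have : a / 4 * s ^+ 2 <= a / 4 * (2 * (p ^+ 2 + q ^+ 2)).
    by rewrite ler_wpM2l // divr_ge0 ?(ltW a_gt0).
  by lra.
have D_gt0 : 0 < a ^+ 2 + 2 * mu1 by rewrite addr_gt0 ?exprn_gt0 ?mulr_gt0.
rewrite ler_pdivrMr // -(ler_pM2r b_gt0).
have hb := le_trans coarea tv.
(* The factor [2 * a * mu1] turns [M] into [mu1 * M], ready for the Robin inequality. The energy
   then has total coefficient [a ^+ 2 + 2 * mu1], the denominator of the bound, and [b] collects
   [a ^+ 2 * (k + mu1)]. *)
have : 2 * a * mu1 * (h * b) <= 2 * a * mu1 * (a^-1 * energy g g + a / 2 * (M + b)).
  by rewrite ler_pM2l ?mulr_gt0.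
have -> : 2 * a * mu1 * (a^-1 * energy g g + a / 2 * (M + b)) =
    2 * mu1 * energy g g + a ^+ 2 * (mu1 * M) + a ^+ 2 * mu1 * b.
  by field; rewrite gt_eqF.
have := ler_wpM2l (sqr_ge0 a) robin.
have := ler_wpM2l (ltW D_gt0) eg.
by lra.
Qed.

Lemma steklovN (u : U) l : is_steklov l u -> is_steklov l (- u : U).
Proof.
move=> [uE uo]; split=> [v|x /uo ux]; last by rewrite ffunE ux oppr0.
have := uE v; rewrite !green /wform => /(congr1 -%R); rewrite -mulrN -!sumrN => h.
transitivity (\sum_x - (v x * outflow u x)).
  apply: eq_bigr => x _; rewrite -mulrN /outflow -sumrN; congr (_ * _).
  by apply: eq_bigr => y _; rewrite !ffunE; ring.
by rewrite h; congr (_ * _); apply: eq_bigr => x _; rewrite ffunE; ring.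
Qed.

(* Testing against the constant 1, u has mean zero on the boundary. *)
Lemma steklov_pos_part (u : U) l : is_steklov l u -> l != 0 -> u != 0 ->
  0 < \sum_(x in bdry) m x * Num.max 0 (u x) ^+ 2.
Proof.
move=> us l0 u0; have := us.1 (fun=> 1).
rewrite energy_sym green big1 => [|x _]; last first.
  by rewrite /outflow big1 ?mulr0 // => y _; rewrite subrr mulr0.
move=> /esym/eqP; rewrite mulf_eq0 (negbTE l0) /= => /eqP mass0.
have term_ge0 x : x \in bdry -> 0 <= m x * Num.max 0 (u x) ^+ 2.
  by move=> _; rewrite mulr_ge0 ?vm_ge0 ?sqr_ge0.
rewrite lt_def sumr_ge0 // andbT psumr_eq0 //.
apply/negP => /allP npos.
have u_le0 x : x \in bdry -> u x <= 0.
  move=> xB; have := npos x; rewrite mem_index_enum xB /= => /(_ isT).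
  rewrite mulf_eq0 gt_eqF ?vm_gt0 ?bdry_in_closure //= sqrf_eq0.
  by case: ltP => // ux; rewrite gt_eqF.
(* With no positive boundary value, the zero mean forces [u] to vanish on the boundary, contrary to
   [steklov_bdry_gt0]. *)
have term0 : forall x, restr bdry m x * (u x * 1) = 0.
  suff /allP h : all (fun x => xpredT x ==> (- (restr bdry m x * (u x * 1)) == 0)) (index_enum V).
    by move=> x; apply/eqP; rewrite -oppr_eq0; exact: h (mem_index_enum x).
  rewrite -psumr_eq0 ?sumrN ?oppr_eq0 => [|x _]; first exact/eqP.
  rewrite oppr_ge0 /restr mulr1; case: ifP => xB; last by rewrite mul0r.
  by rewrite mulr_ge0_le0 ?vm_ge0 ?u_le0.
have := steklov_bdry_gt0 us u0; rewrite /wform big1 ?ltxx // => x _.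
by have := term0 x; rewrite mulr1 mulrA => ->; rewrite mul0r.
Qed.

(** The sets where [u] is positive and negative are disjoint, so one of [u] and [- u] is positive on
    at most half of the boundary. *)
Lemma meas_pos_neg (u : U) :
  meas mu Omega ([set x | 0 < u x]%SET :&: bdry) +
  meas mu Omega ([set x | 0 < (- u : U) x]%SET :&: bdry) <= meas mu Omega bdry.
Proof.
rewrite /meas big_mkcond [X in _ + X]big_mkcond [leRHS]big_mkcond -big_split.
rewrite ler_sum // => x _; rewrite /= !finset.in_setI; have := vm_ge0 x.
case: (x \in bdry) => [|_]; last by rewrite !andbF addr0.
rewrite !inE !andbT ffunE oppr_gt0.
by case: ltgtP => _ ?; rewrite /= ?addr0 ?add0r.
Qed.
End Domain.

Theorem theorem1p2 (R : realType) (V : finType) (mu : V -> V -> R)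
    (mu_sym : forall x y, mu x y = mu y x)
    (mu_ge0 : forall x y, 0 <= mu x y)
    (Omega : {set V}) (Omega_neq0 : Omega != finset.set0)
    (Omega_connected : tconnected mu Omega)
    (bdry_ge2 : (2 <= #|vbdry mu Omega|)%N)
    (a k : R) (a_gt0 : 0 < a) (k_gt0 : 0 < k) :
  let h := escobar_cheeger mu Omega in
  let mu1 := robin_eigenvalue1 mu Omega k in
  DtN_eigenvalue mu Omega 1 >=
    (2 * h * mu1 - a * (k + mu1)) * a / (a ^+ 2 + 2 * mu1).
Proof.
rewrite /=.
have [l_neq0 [u us u_neq0]] := DtN_eigenvalue1P mu_sym mu_ge0 Omega_connected bdry_ge2.
have usN := steklovN mu_sym us.
have uN_neq0 : (- u : {ffun V -> R^o}) != 0 by rewrite oppr_eq0.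
have total := meas_pos_neg Omega mu_sym mu_ge0 u.
set X := meas _ _ (_ :&: _) in total; set Y := meas _ _ (_ :&: _) in total.
have [X_le|X_gt] := lerP X (2^-1 * meas mu Omega (vbdry mu Omega)).
  apply: (steklov_cheeger mu_sym mu_ge0 Omega_connected bdry_ge2 k_gt0 Omega_neq0 a_gt0 us) => //.
  exact: (steklov_pos_part mu_sym mu_ge0 Omega_connected bdry_ge2 us l_neq0 u_neq0).
apply: (steklov_cheeger mu_sym mu_ge0 Omega_connected bdry_ge2 k_gt0 Omega_neq0 a_gt0 usN) => //.
  exact: (steklov_pos_part mu_sym mu_ge0 Omega_connected bdry_ge2 usN l_neq0 uN_neq0).
by rewrite -/Y; lra.
Qed.
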